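(* If $f:\overline{(U,E)}\to\overline{(V,E')}$ and $g:\overline{(V,E')}\to\overline{(W,E'')}$ are two one-one onto hesitant fuzzy soft mappings, then $(g\circ f)^{-1}=f^{-1}\circ g^{-1}$.
   Context: All universes ($U,V,W$) and attribute (parameter) sets ($E,E',E''$) are nonempty sets. A hesitant fuzzy element (HFE) is a nonempty subset of $[0,1]$. A hesitant fuzzy set on $U$ assigns to each $x\in U$ an HFE. A hesitant fuzzy soft set $F_A$ over $U$ with attributes from $E$ is given by a nonempty $A\subseteq E$ and, for each $e\in A$, a hesitant fuzzy set $F(e)$ on $U$; write $F_A(e)(x)$ for the HFE of $x\in U$ at $e$. By convention $F_A(e)(x)=\{0\}$ for $e\in E\setminus A$, and two hesitant fuzzy soft sets over $U$ with attributes from $E$ are equal when they agree as functions of $(e,x)\in E\times U$. The hesitant fuzzy soft class $\overline{(U,E)}$ is the collection of all hesitant fuzzy soft sets over $U$ with attributes from $E$. The union of HFEs is $\mu_1\cup\mu_2=\{\max(\gamma_1,\gamma_2):\gamma_1\in\mu_1,\gamma_2\in\mu_2\}$; for a nonempty family, $\bigcup_i\mu_i=\{\sup_i\gamma_i:\gamma_i\in\mu_i \text{ for all } i\}$ (so the maximum for finite families), and the union of the empty family is $\{0\}$. Given maps $p:U\to V$ and $q:E\to E'$, the hesitant fuzzy soft mapping $f=(p,q):\overline{(U,E)}\to\overline{(V,E')}$ sends $F_A$ to its image $f(F_A)$ defined, for $\beta\in E'$ and $y\in V$, by $f(F_A)(\beta)(y)=\bigcup_{\alpha\in q^{-1}(\beta)\cap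 A,\ s\in p^{-1}(y)}F_A(\alpha)(s)$. Two hesitant fuzzy soft mappings are equal when they are equal as mappings between classes. The mapping $f=(p,q)$ is one-one if both $p$ and $q$ are one-one, and onto if both $p$ and $q$ are onto. If $f=(p,q)$ is one-one and onto, its hesitant fuzzy soft inverse mapping is $f^{-1}=(p^{-1},q^{-1}):\overline{(V,E')}\to\overline{(U,E)}$; it satisfies $f^{-1}(G_B)=F_A$ whenever $f(F_A)=G_B$. The composite $g\circ f$ of $f=(p,q)$ and $g=(r,t)$ is the hesitant fuzzy soft mapping $\overline{(U,E)}\to\overline{(W,E'')}$ satisfying $(g\circ f)(F_A)=g(f(F_A))$ for every $F_A\in\overline{(U,E)}$; its underlying pair of maps is $(r\circ p,\,t\circ q)$. *)

(* Defs.v *)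
From HB Require Import structures.
From mathcomp Require Import all_boot all_order all_algebra.
From mathcomp Require Import boolp classical_sets functions set_interval reals.

Set Implicit Arguments.
Unset Strict Implicit.
Unset Printing Implicit Defensive.

Import Order.TTheory GRing.Theory Num.Theory.

Local Open Scope classical_set_scope.
Local Open Scope ring_scope.

Section HesitantFuzzyElement.
Variable R : realType.

Record hfe := HFE {
  hfe_set : set R;
  hfe_neq0 : hfe_set !=set0;
  hfe_sub01 : hfe_set `<=` `[0, 1] }.

Lemma hfeP (mu nu : hfe) : hfe_set mu = hfe_set nu -> mu = nu.
Proof.
case: mu nu => [S S0 S1] [T T0 T1] /= ST; subst T.
by rewrite (Prop_irrelevance S0 T0) (Prop_irrelevance S1 T1).
Qed.

Lemma hfe_itv (mu : hfe) x : hfe_set mu x -> 0 <= x <= 1.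
Proof. by move/(@hfe_sub01 mu); rewrite /= in_itv. Qed.

Lemma hfe0_sub01 : [set (0 : R)] `<=` `[0, 1].
Proof. by move=> _ ->; rewrite /= in_itv /= lexx ler01. Qed.

Definition hfe0 : hfe := HFE (ex_intro _ 0 erefl) hfe0_sub01.

Lemma sup_itv01 (S : set R) : (forall x, S x -> 0 <= x <= 1) -> 0 <= sup S <= 1.
Proof.
move=> S01; have [->|/set0P [x Sx]] := eqVneq S set0.
  by rewrite sup0 lexx ler01.
have ubS : has_ubound S by exists 1 => y /S01 /andP[].
apply/andP; split; last by apply: ge_sup; [exists x|move=> y /S01 /andP[]].
by apply: (le_trans _ (ub_le_sup ubS Sx)); case/andP: (S01 _ Sx).
Qed.

Lemma sup_le01 (S T : set R) : 0 <= sup T ->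
  (forall x, S x -> x <= sup T) -> sup S <= sup T.
Proof.
move=> T0 ST; have [->|/set0P S0] := eqVneq S set0; first by rewrite sup0.
exact: ge_sup.
Qed.

Section Union.
Variables (I : Type) (D : set I) (mu : I -> hfe).

(* [g] selects an element of each [mu i] with [D i]; its values outside [D] are
   irrelevant.  Since [sup set0 = 0], the union over an empty [D] is [hfe0]
   (see [hfe_bigcup0]). *)
Definition hfe_bigcup_set : set R :=
  [set sup (g @` D) | g in [set g : I -> R | forall i, D i -> hfe_set (mu i) (g i)]].

Lemma hfe_bigcup_neq0 : hfe_bigcup_set !=set0.
Proof.
pose g i := projT1 (cid (hfe_neq0 (mu i))).
exists (sup (g @` D)), g => //= i _.
by rewrite /g; case: cid.
Qed.

Lemma hfe_bigcup_sub01 : hfe_bigcup_set `<=` `[0, 1].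
Proof.
move=> _ [g gP <-]; rewrite /= in_itv /=; apply: sup_itv01.
by move=> _ [i Di <-]; apply: (@hfe_itv (mu i)); apply: gP.
Qed.

Definition hfe_bigcup : hfe := HFE hfe_bigcup_neq0 hfe_bigcup_sub01.

End Union.

Lemma hfe_bigcup0 (I : Type) (mu : I -> hfe) : hfe_bigcup set0 mu = hfe0.
Proof.
apply: hfeP; apply/seteqP; split=> [_ [g _ <-]|_ ->] /=.
  by rewrite image_set0 sup0.
by exists (fun=> 0) => //; rewrite image_set0 sup0.
Qed.

Lemma hfe_bigcup1 (I : Type) (j : I) (mu : I -> hfe) :
  hfe_bigcup [set j] mu = mu j.
Proof.
apply: hfeP; apply/seteqP; split=> [_ [g gP <-]|x mux] /=.
  by rewrite image_set1 sup1; apply: gP.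
by exists (fun=> x) => [i ->//|]; rewrite image_set1 sup1.
Qed.

End HesitantFuzzyElement.

Arguments hfe0 {R}.

Section HesitantFuzzySoftClass.
Variable R : realType.

(* [hfss R U E] represents the class of hesitant fuzzy soft sets; its equality is
   [hfss_eq], which forgets the attribute set [A], not Leibniz equality. *)
Record hfss (U E : Type) := HFSS {
  hfss_attr : set E;
  hfss_attr_neq0 : hfss_attr !=set0;
  hfss_val :> E -> U -> hfe R;
  hfss_out : forall e x, ~ hfss_attr e -> hfss_val e x = hfe0 }.

Definition hfss_eq (U E : Type) (F G : hfss U E) : Prop :=
  forall e x, F e x = G e x.

End HesitantFuzzySoftClass.

(* A mapping is presented by its pair [(p, q)] and coerced below to the function
   [hfss R U E -> hfss R V E'] it induces, which is why [hfsm] is indexed by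
   [R]; equality of mappings is [hfsm_eq]. *)
Record hfsm (R : realType) (U E V E' : Type) := HFSM {
  hfsm_univ : U -> V;
  hfsm_attr : E -> E' }.

Section Image.
Variables (R : realType) (U E V E' : Type).
Variables (f : hfsm R U E V E') (F : hfss R U E).
Let p := hfsm_univ f.
Let q := hfsm_attr f.
Let A := hfss_attr F.

Definition hfsm_image_val (b : E') (y : V) : hfe R :=
  hfe_bigcup ((q @^-1` [set b] `&` A) `*` (p @^-1` [set y]))
             (fun i => F i.1 i.2).

Lemma hfsm_image_attr_neq0 : q @` A !=set0.
Proof. by have [a Aa] := hfss_attr_neq0 F; exists (q a), a. Qed.

Lemma hfsm_image_out b y : ~ (q @` A) b -> hfsm_image_val b y = hfe0.
Proof.
move=> nAb; rewrite /hfsm_image_val.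
suff -> : q @^-1` [set b] `&` A = set0 by rewrite set0X hfe_bigcup0.
by rewrite -subset0 => a [qa Aa]; apply: nAb; exists a.
Qed.

Definition hfsm_image : hfss R V E' := HFSS hfsm_image_attr_neq0 hfsm_image_out.

End Image.

Coercion hfsm_image : hfsm >-> Funclass.

Section Mappings.
Variable R : realType.

Definition hfsm_eq (U E V E' : Type) (f g : hfsm R U E V E') : Prop :=
  forall F : hfss R U E, hfss_eq (f F) (g F).

Definition hfsm_one_one (U E V E' : Type) (f : hfsm R U E V E') : Prop :=
  injective (hfsm_univ f) /\ injective (hfsm_attr f).

Definition hfsm_onto (U E V E' : Type) (f : hfsm R U E V E') : Prop :=
  set_surj setT setT (hfsm_univ f) /\ set_surj setT setT (hfsm_attr f).

(* [pinv setT p] is the inverse of [p] only when [p] is bijective, so this is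
   meaningful only for one-one onto mappings. *)
Definition hfsm_inv (U E : pointedType) (V E' : Type) (f : hfsm R U E V E') :
    hfsm R V E' U E :=
  HFSM R (pinv setT (hfsm_univ f)) (pinv setT (hfsm_attr f)).

Definition hfsm_comp (U E V E' W E'' : Type)
    (g : hfsm R V E' W E'') (f : hfsm R U E V E') : hfsm R U E W E'' :=
  HFSM R (hfsm_univ g \o hfsm_univ f) (hfsm_attr g \o hfsm_attr f).

Lemma hfsm_image_eq (U E V E' : Type) (f : hfsm R U E V E') (F G : hfss R U E) :
  hfss_eq F G -> hfss_eq (f F) (f G).
Proof.
suff sub (F' G' : hfss R U E) b y :
    hfss_eq F' G' -> hfe_set (f F' b y) `<=` hfe_set (f G' b y).
  by move=> FG b y; apply: hfeP; apply/seteqP; split; apply: sub.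
move=> FG _ [g gP <-] /=.
pose A := hfss_attr F'.
pose h i := if pselect (A i.1) then g i else 0.
set DF := (_ `*` _) in gP *.
pose DG := (hfsm_attr f @^-1` [set b] `&` hfss_attr G') `*`
           (hfsm_univ f @^-1` [set y]).
have hP i : DG i -> hfe_set (G' i.1 i.2) (h i).
  move=> [[qi Bi] pi]; rewrite -FG /h; case: pselect => Ai.
    exact: (gP i).
  by rewrite hfss_out.
have g01 : 0 <= sup (g @` DF).
  suff /andP[] : 0 <= sup (g @` DF) <= 1 by [].
  by apply: sup_itv01 => _ [i Di <-]; apply: hfe_itv (gP _ Di).
have h01 x : (h @` DG) x -> 0 <= x <= 1.
  by move=> [i Di <-]; apply: hfe_itv (hP _ Di).
have g01' x : (g @` DF) x -> 0 <= x <= 1.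
  by move=> [i Di <-]; apply: hfe_itv (gP _ Di).
have h0 : 0 <= sup (h @` DG) by have /andP[] := sup_itv01 h01.
exists h => //; apply/eqP; rewrite eq_le; apply/andP; split.
  apply: sup_le01 => // _ [i [[qi Bi] pi] <-]; rewrite /h.
  case: pselect => // Ai; apply: ub_le_sup; last by exists i.
  by exists 1 => x /g01' /andP[].
apply: sup_le01 => // _ [i [[qi Ai] pi] <-].
have [Bi|nBi] := pselect (hfss_attr G' i.1).
  apply: ub_le_sup; first by exists 1 => x /h01 /andP[].
  by exists i => //; rewrite /h; case: pselect.
by have := gP i (conj (conj qi Ai) pi); rewrite /= FG hfss_out //= => ->.
Qed.

Lemma hfsm_compE (U E V E' W E'' : Type) (g : hfsm R V E' W E'')
    (f : hfsm R U E V E') (F : hfss R U E) :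
  hfss_eq (hfsm_comp g f F) (g (f F)).
Proof.
move=> c z; apply: hfeP.
pose p := hfsm_univ f; pose q := hfsm_attr f.
pose r := hfsm_univ g; pose t := hfsm_attr g.
pose A := hfss_attr F.
pose D1 := ((t \o q) @^-1` [set c] `&` A) `*` ((r \o p) @^-1` [set z]).
pose D2 := (t @^-1` [set c] `&` q @` A) `*` (r @^-1` [set z]).
pose D i := (q @^-1` [set i.1] `&` A) `*` (p @^-1` [set i.2]).
have key (h : E * U -> R) (d : E' * V -> R) :
    (forall i, D1 i -> 0 <= h i <= 1) ->
    (forall i, D2 i -> d i = sup (h @` D i)) ->
    sup (d @` D2) = sup (h @` D1).
  move=> h01 dE.
  have D12 i j : D2 i -> D i j -> D1 j.
    by move=> [[/= ti _] ri] [[/= qj Aj] pj]; split; [split|];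
      rewrite //= ?qj ?pj.
  have hD1 x : (h @` D1) x -> 0 <= x <= 1 by move=> [i /h01 ? <-].
  have hD i x : D2 i -> (h @` D i) x -> 0 <= x <= 1.
    by move=> D2i [j Dj <-]; apply: h01; apply: D12 Dj.
  have dD2 x : (d @` D2) x -> 0 <= x <= 1.
    by move=> [i D2i <-]; rewrite dE //; apply: sup_itv01 => y; apply: hD.
  have [d0 h0] : 0 <= sup (d @` D2) /\ 0 <= sup (h @` D1).
    by split; [have /andP[] := sup_itv01 dD2|have /andP[] := sup_itv01 hD1].
  apply/eqP; rewrite eq_le; apply/andP; split; apply: sup_le01 => //.
    move=> _ [i D2i <-]; rewrite dE //; apply: sup_le01 => // _ [j Dj <-].
    apply: ub_le_sup; first by exists 1 => x /hD1 /andP[].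
    by exists j => //; apply: D12 Dj.
  move=> _ [j D1j <-]; pose i := (q j.1, p j.2).
  have [[tj Aj] rj] := D1j.
  have D2i : D2 i by split => //; split => //; exists j.1.
  apply: (@le_trans _ _ (d i)); last first.
    by apply: ub_le_sup; [exists 1 => x /dD2 /andP[]|exists i].
  rewrite dE //; apply: ub_le_sup; last by exists j.
  by exists 1 => x /(hD _ _ D2i) /andP[].
apply/seteqP; split=> [_ [h hP <-]|_ [d dP <-]] /=.
  exists (fun i => sup (h @` D i)); last first.
    by apply: key => // i /hP /hfe_itv.
  move=> i [[ti _] ri]; exists h => // j [[qj Aj] pj]; apply: hP.
  by split; [split|]; rewrite //= ?qj ?pj.
have /choice [k kP] : forall i, exists h : E * U -> R, D2 i ->
    (forall j, D i j -> hfe_set (F j.1 j.2) (h j)) /\ d i = sup (h @` D i).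
  move=> i; have [D2i|nD2i] := pselect (D2 i); last by exists (fun=> 0).
  by have [h hP hE] := dP _ D2i; exists h.
pose h j := k (q j.1, p j.2) j.
have hP j : D1 j -> hfe_set (F j.1 j.2) (h j).
  move=> [[tj Aj] rj].
  have D2i : D2 (q j.1, p j.2) by split => //; split => //; exists j.1.
  by have [+ _] := kP _ D2i; apply.
exists h => //; apply/esym/key => [i /hP /hfe_itv //|i D2i].
have [_ ->] := kP _ D2i; congr sup.
apply/seteqP; split=> _ [j Dj <-]; exists j => //;
  by case: i Dj {D2i} => b y [[/= <- _] <-].
Qed.

Lemma hfsm_one_oneE (U E V E' : Type) (f : hfsm R U E V E') (F : hfss R U E) :
  hfsm_one_one f ->
  forall a x, f F (hfsm_attr f a) (hfsm_univ f x) = F a x.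
Proof.
move=> [pI qI] a x; have [Aa|nAa] := pselect (hfss_attr F a).
  rewrite -(hfe_bigcup1 (a, x) (fun i => F i.1 i.2)) /= /hfsm_image_val.
  congr hfe_bigcup; apply/seteqP; split=> [[b y] [[/= /qI -> _] /pI -> //]|].
  by move=> _ ->.
rewrite [RHS]hfss_out // hfss_out //= => -[b Ab /qI ba].
by apply: nAa; rewrite -ba.
Qed.

Lemma hfsm_invE (U E : pointedType) (V E' : Type) (f : hfsm R U E V E')
    (F : hfss R U E) (G : hfss R V E') :
  hfsm_one_one f -> hfsm_onto f -> hfss_eq (f F) G ->
  hfss_eq (hfsm_inv f G) F.
Proof.
move=> f11 [pS qS] fFG a x; have [pI qI] := f11.
have pK : cancel (hfsm_univ f) (pinv setT (hfsm_univ f)).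
  by move=> y; apply: pinvKV; rewrite ?inE // => ? ? _ _ /pI.
have qK : cancel (hfsm_attr f) (pinv setT (hfsm_attr f)).
  by move=> y; apply: pinvKV; rewrite ?inE // => ? ? _ _ /qI.
rewrite -(hfsm_one_oneE F f11) fFG -{1}[a]qK -{1}[x]pK.
apply: hfsm_one_oneE; split=> u v /=.
- by apply: (surjpinv_inj pS); rewrite inE.
- by apply: (surjpinv_inj qS); rewrite inE.
Qed.

End Mappings.

(* Main.v *)
Require Import Defs.
From mathcomp Require Import all_boot all_order all_algebra.
From mathcomp Require Import boolp classical_sets functions reals.

(** A mapping of hesitant fuzzy soft classes is determined by its pair of
    underlying maps, and both inverse and composition are computed
    componentwise.  The theorem therefore reduces to the identity
    [(h \o k)^-1 = k^-1 \o h^-1] for bijections [k] and [h] (lemma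
    [pinv_comp_bij]), applied once to the maps between universes and once to the
    maps between attribute sets.  The two mappings then coincide as pairs of
    maps, a fortiori as mappings between classes. *)

Lemma injective_pinvK {T : pointedType} {T' : Type} {k : T -> T'} :
  injective k -> cancel k (pinv setT k).
Proof. by move=> kI x; apply: pinvKV; rewrite ?inE // => ? ? _ _ /kI. Qed.

(** Every [z] is [h (k x)] for some [x], and both sides send [h (k x)] to [x]. *)
Lemma pinv_comp_bij {X Y : pointedType} {Z : Type} {k : X -> Y} {h : Y -> Z} :
  injective k -> set_surj setT setT k ->
  injective h -> set_surj setT setT h ->
  pinv setT (h \o k) = pinv setT k \o pinv setT h.
Proof.
move=> kI kS hI hS; apply/funext => z.
have [y _ <-] := hS z I; have [x _ <-] := kS y I.
rewrite /= (injective_pinvK hI) (injective_pinvK kI).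
exact: (injective_pinvK (inj_comp hI kI)).
Qed.

Theorem theorem3p24 (R : realType) (U V W E E' E'' : pointedType)
    (f : hfsm R U E V E') (g : hfsm R V E' W E'')
    (f_one_one : hfsm_one_one f) (f_onto : hfsm_onto f)
    (g_one_one : hfsm_one_one g) (g_onto : hfsm_onto g) :
  hfsm_eq (hfsm_inv (hfsm_comp g f)) (hfsm_comp (hfsm_inv f) (hfsm_inv g)).
Proof.
have [pI qI] := f_one_one; have [pS qS] := f_onto.
have [rI tI] := g_one_one; have [rS tS] := g_onto.
suff -> : hfsm_inv (hfsm_comp g f) = hfsm_comp (hfsm_inv f) (hfsm_inv g) by [].
rewrite /hfsm_inv /hfsm_comp /=.
by rewrite (pinv_comp_bij pI pS rI rS) (pinv_comp_bij qI qS tI tS).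
Qed.
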